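(* Let $E$ be a finite graph and $K$ any field. Let $$E = E_0\rightarrow E_1\rightarrow\cdots\rightarrow E_i\rightarrow\cdots\rightarrow E_\ell = E_{sf}$$ be a sequence of graphs which arises in some step-by-step process of source eliminations. Then the Leavitt path algebra $L_K(E)$ has Unbounded Generating Number if and only if either $E_i$ contains an isolated vertex for some $0\leq i\leq \ell$, or $E_{sf}$ contains a source cycle.
   Context: A ring $R$ (nonzero, associative, with identity) has Unbounded Generating Number (UGN) if, for each positive integer $m$, any set of generators for the free right $R$-module $R^m$ has cardinality $\geq m$. A (directed) graph $E=(E^0,E^1,s,r)$ consists of disjoint sets $E^0$ (vertices) and $E^1$ (edges) and maps $s,r:E^1\to E^0$ (source and range); it is finite if $E^0$ and $E^1$ are finite. The given graph $E$ is assumed to have at least one vertex. A vertex $v$ is a sink if $s^{-1}(v)=\emptyset$, a source if $r^{-1}(v)=\emptyset$, isolated if it is both a source and a sink, and regular if $0<|s^{-1}(v)|<\infty$. A graph is source-free if it has no sources. For a field $K$, $L_K(E)$ is the $K$-algebra generated by the set $\{v,e,e^*\mid v\in E^0,e\in E^1\}$ subject to, for all $v,w\in E^0$, $e,f\in E^1$: (1) $vw=\delta_{v,w}w$; (2) $s(e)e=e=er(e)$ and $r(e)e^*=e^*=e^*s(e)$; (3) $e^*f=\delta_{e,f}r(e)$; (4) $v=\sum_{e\in s^{-1}(v)}ee^*$ for every regular vertex $v$. For finite $E$ it is unital with identity $\sum_{v\in E^0}v$. A closed path is a sequence of edges $e_1\cdots e_n$ ($n\ge 1$) with $r(e_i)=s(e_{i+1})$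 for $1\le i<n$ and $r(e_n)=s(e_1)$. If the vertices $s(e_1),\dots,s(e_n)$ are distinct, the subgraph $c$ with vertex set $c^0=\{s(e_1),\dots,s(e_n)\}$ and edge set $\{e_1,\dots,e_n\}$ is called a cycle. A cycle $c$ in a graph is a source cycle if $|r^{-1}(v)|=1$ for all $v\in c^0$ (with $r^{-1}(v)$ computed in that graph). If $v$ is a source of a graph $E$, the source elimination graph $E_{\setminus v}$ is obtained by deleting $v$ and all edges emitted by $v$: $(E_{\setminus v})^0=E^0\setminus\{v\}$, $(E_{\setminus v})^1=E^1\setminus s^{-1}(v)$, with $s,r$ restricted. Let $E_{triv}$ be the graph with one vertex and no edges. A step-by-step process of source eliminations is a sequence $E=E_0\to E_1\to\cdots\to E_\ell$ in which each $E_{i+1}$ is $(E_i)_{\setminus v}$ for some source $v$ of $E_i$, continued until a source-free graph is reached; this final graph is denoted $E_{sf}=E_\ell$. To avoid the empty graph, if $E_{\ell-1}=E_{triv}$ (so that eliminating its unique vertex would give the empty graph), one sets $E_\ell=E_{sf}=E_{triv}$. *)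

(* Defs.v *)
From HB Require Import structures.
From mathcomp Require Import all_boot all_order all_algebra.
From mathcomp Require Import boolp classical_sets functions cardinality.

Set Implicit Arguments.
Unset Strict Implicit.
Unset Printing Implicit Defensive.

Import GRing.Theory.
Local Open Scope quotient_scope.
Local Open Scope ring_scope.

(* The free right R-module R^m is 'cV[R]_m, scalars acting on the right of each
   coordinate; MathComp's own scaling on matrices is the left one. *)
Definition rscale (R : pzRingType) (m : nat) (x : 'cV[R]_m) (a : R) : 'cV[R]_m :=
  \col_k (x k 0 * a).

Definition right_generates (R : pzRingType) (m : nat) (S : set 'cV[R]_m) : Prop :=
  forall x : 'cV[R]_m, exists (n : nat) (g : 'I_n -> 'cV[R]_m) (a : 'I_n -> R),
    (forall j, S (g j)) /\ x = \sum_j rscale (g j) (a j).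

(* pzRingType admits the zero ring; it is not UGN (take m = 1 and S empty). *)
Definition UGN (R : pzRingType) : Prop :=
  forall m : nat, (0 < m)%N ->
    forall S : set 'cV[R]_m, right_generates S -> (`I_m #<= S)%card.

Record digraph := Digraph {
  vertex : finType;
  edge : finType;
  src : edge -> vertex;
  tgt : edge -> vertex
}.

Section Graphs.
Variable G : digraph.
Implicit Types (v : vertex G) (p : seq (edge G)).

Definition out_edges v : {set edge G} := [set e | src e == v].
Definition in_edges v : {set edge G} := [set e | tgt e == v].

Definition is_sink v : bool := out_edges v == finset.set0.
Definition is_source v : bool := in_edges v == finset.set0.
Definition isolated v : bool := is_source v && is_sink v.
Definition regular_vertex v : bool := (0 < #|out_edges v|)%N.

Definition source_free : Prop := forall v, ~~ is_source v.
Definition has_isolated_vertex : Prop := exists v, isolated v.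
Definition is_trivial_graph : Prop :=
  #|vertex G| = 1%N /\ #|edge G| = 0%N.

(* path.cycle also links the last edge back to the first one. *)
Definition closed_path p : bool :=
  (0 < size p)%N && cycle (fun e f => tgt e == src f) p.
Definition is_cycle p : bool := closed_path p && uniq (map (@src G) p).
Definition is_source_cycle p : bool :=
  is_cycle p && all (fun v => #|in_edges v| == 1%N) (map (@src G) p).
Definition has_source_cycle : Prop := exists p, is_source_cycle p.

Lemma source_tgt v (hv : is_source v) (e : edge G) : tgt e != v.
Proof.
by apply/negP => ev; move/eqP/setP/(_ e): hv; rewrite !inE ev.
Qed.

End Graphs.

Definition source_elim (G : digraph) (v : vertex G) (hv : is_source v) : digraph :=
  @Digraph {w : vertex G | w != v} {e : edge G | src e != v}
    (fun e => exist _ (src (val e)) (valP e))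
    (fun e => exist _ (tgt (val e)) (source_tgt hv (val e))).

(* One step G -> H.  The second clause is the convention avoiding the empty
   graph: eliminating the only vertex of E_triv yields E_triv again. *)
Inductive elim_step (G : digraph) : digraph -> Prop :=
| ElimSource (v : vertex G) (hv : is_source v) :
    ~ is_trivial_graph G -> elim_step G (source_elim hv)
| ElimTriv : is_trivial_graph G -> elim_step G G.

(* E = G 0 -> ... -> G l = E_sf; the values of G beyond l are irrelevant.  The
   process halts at l either because G l is source-free or because G l.-1 was
   already E_triv (and not earlier for that latter reason). *)
Definition elim_process (E : digraph) (l : nat) (G : nat -> digraph) : Prop :=
  [/\ G 0%N = E,
      forall i, (i < l)%N -> elim_step (G i) (G i.+1),
      forall i, (i.+1 < l)%N -> ~ is_trivial_graph (G i) &
      source_free (G l) \/ (0 < l)%N /\ is_trivial_graph (G l.-1)].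

(* Non-unital K-algebra expressions in the generators v, e, e^*. *)
Inductive lpa_term (K : fieldType) (G : digraph) : Type :=
| LVert of vertex G
| LEdge of edge G
| LGhost of edge G
| LZero
| LOpp of lpa_term K G
| LAdd of lpa_term K G & lpa_term K G
| LScale of K & lpa_term K G
| LMul of lpa_term K G & lpa_term K G.

Arguments LVert {K G}.
Arguments LEdge {K G}.
Arguments LGhost {K G}.
Arguments LZero {K G}.
Arguments LOpp {K G}.
Arguments LAdd {K G}.
Arguments LScale {K G}.
Arguments LMul {K G}.

(* The least congruence making the expressions an associative K-algebra in which
   the defining relations of L_K(G) hold. *)
Inductive lpa_eq (K : fieldType) (G : digraph) :
    lpa_term K G -> lpa_term K G -> Prop :=
| LRefl x : lpa_eq x x
| LSym x y : lpa_eq x y -> lpa_eq y x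
| LTrans x y z : lpa_eq x y -> lpa_eq y z -> lpa_eq x z
| LOppC x y : lpa_eq x y -> lpa_eq (LOpp x) (LOpp y)
| LAddC x x' y y' :
    lpa_eq x x' -> lpa_eq y y' -> lpa_eq (LAdd x y) (LAdd x' y')
| LScaleC a x y : lpa_eq x y -> lpa_eq (LScale a x) (LScale a y)
| LMulC x x' y y' :
    lpa_eq x x' -> lpa_eq y y' -> lpa_eq (LMul x y) (LMul x' y')
| LaddA x y z : lpa_eq (LAdd x (LAdd y z)) (LAdd (LAdd x y) z)
| LaddC x y : lpa_eq (LAdd x y) (LAdd y x)
| Ladd0 x : lpa_eq (LAdd LZero x) x
| LaddN x : lpa_eq (LAdd (LOpp x) x) LZero
| LscaleA a b x : lpa_eq (LScale a (LScale b x)) (LScale (a * b) x)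
| Lscale1 x : lpa_eq (LScale 1 x) x
| LscaleDr a x y :
    lpa_eq (LScale a (LAdd x y)) (LAdd (LScale a x) (LScale a y))
| LscaleDl a b x :
    lpa_eq (LScale (a + b) x) (LAdd (LScale a x) (LScale b x))
| LmulA x y z : lpa_eq (LMul x (LMul y z)) (LMul (LMul x y) z)
| LmulDl x y z : lpa_eq (LMul (LAdd x y) z) (LAdd (LMul x z) (LMul y z))
| LmulDr x y z : lpa_eq (LMul x (LAdd y z)) (LAdd (LMul x y) (LMul x z))
| LscaleAl a x y : lpa_eq (LScale a (LMul x y)) (LMul (LScale a x) y)
| LscaleAr a x y : lpa_eq (LScale a (LMul x y)) (LMul x (LScale a y))
| Lvv v w : lpa_eq (LMul (LVert v) (LVert w)) (if v == w then LVert w else LZero)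
| Lse e : lpa_eq (LMul (LVert (src e)) (LEdge e)) (LEdge e)
| Ler e : lpa_eq (LMul (LEdge e) (LVert (tgt e))) (LEdge e)
| Lrg e : lpa_eq (LMul (LVert (tgt e)) (LGhost e)) (LGhost e)
| Lgs e : lpa_eq (LMul (LGhost e) (LVert (src e))) (LGhost e)
| Lge e f :
    lpa_eq (LMul (LGhost e) (LEdge f)) (if e == f then LVert (tgt e) else LZero)
| Lck v : regular_vertex v ->
    lpa_eq (LVert v)
      (\big[LAdd/LZero]_(e in out_edges v) LMul (LEdge e) (LGhost e)).

HB.instance Definition _ (K : fieldType) (G : digraph) :=
  gen_eqMixin (lpa_term K G).
HB.instance Definition _ (K : fieldType) (G : digraph) :=
  gen_choiceMixin (lpa_term K G).

Section LeavittPathAlgebra.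
Variables (K : fieldType) (G : digraph).
Local Notation term := (lpa_term K G).

Definition lpa_eqb (x y : term) : bool := `[< lpa_eq x y >].

Lemma lpa_eqb_refl : reflexive lpa_eqb.
Proof. by move=> x; apply/asboolP; apply: LRefl. Qed.

Lemma lpa_eqb_sym : symmetric lpa_eqb.
Proof. by move=> x y; apply/asboolP/asboolP; apply: LSym. Qed.

Lemma lpa_eqb_trans : transitive lpa_eqb.
Proof.
by move=> y x z /asboolP xy /asboolP yz; apply/asboolP; apply: LTrans xy yz.
Qed.

Canonical lpa_equiv : equiv_rel term :=
  EquivRel lpa_eqb lpa_eqb_refl lpa_eqb_sym lpa_eqb_trans.

Definition leavitt : Type := {eq_quot lpa_equiv}.

HB.instance Definition _ := Choice.on leavitt.
HB.instance Definition _ : EqQuotient _ lpa_equiv leavitt :=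
  EqQuotient.on leavitt.

Local Notation "[ x ]L" := (\pi_leavitt x) (format "[ x ]L").

Lemma lpa_piP (x y : term) : [x]L = [y]L <-> lpa_eq x y.
Proof.
split; first by move=> /eqquotP /asboolP.
by move=> xy; apply/eqquotP/asboolP.
Qed.

Lemma lpa_repr (x : term) : lpa_eq (repr [x]L) x.
Proof. by apply/lpa_piP; rewrite reprK. Qed.

Definition lpa_opp (x : leavitt) : leavitt := [LOpp (repr x)]L.
Definition lpa_add (x y : leavitt) : leavitt := [LAdd (repr x) (repr y)]L.
Definition lpa_scale (a : K) (x : leavitt) : leavitt := [LScale a (repr x)]L.
Definition lpa_mul (x y : leavitt) : leavitt := [LMul (repr x) (repr y)]L.

Lemma lpa_oppE x : lpa_opp [x]L = [LOpp x]L.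
Proof. by apply/lpa_piP/LOppC/lpa_repr. Qed.

Lemma lpa_addE x y : lpa_add [x]L [y]L = [LAdd x y]L.
Proof. by apply/lpa_piP/LAddC; apply: lpa_repr. Qed.

Lemma lpa_scaleE a x : lpa_scale a [x]L = [LScale a x]L.
Proof. by apply/lpa_piP/LScaleC/lpa_repr. Qed.

Lemma lpa_mulE x y : lpa_mul [x]L [y]L = [LMul x y]L.
Proof. by apply/lpa_piP/LMulC; apply: lpa_repr. Qed.

Lemma lpa_addA : associative lpa_add.
Proof.
by elim/quotW=> x; elim/quotW=> y; elim/quotW=> z;
  rewrite (lpa_addE y z) (lpa_addE x y) !lpa_addE; apply/lpa_piP; apply: LaddA.
Qed.

Lemma lpa_addC : commutative lpa_add.
Proof.
by elim/quotW=> x; elim/quotW=> y; rewrite !lpa_addE; apply/lpa_piP; apply: LaddC.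
Qed.

Lemma lpa_add0 : left_id [LZero]L lpa_add.
Proof. by elim/quotW=> x; rewrite lpa_addE; apply/lpa_piP; apply: Ladd0. Qed.

Lemma lpa_addN : left_inverse [LZero]L lpa_opp lpa_add.
Proof.
by elim/quotW=> x; rewrite lpa_oppE lpa_addE; apply/lpa_piP; apply: LaddN.
Qed.

HB.instance Definition _ :=
  GRing.isZmodule.Build leavitt lpa_addA lpa_addC lpa_add0 lpa_addN.

Lemma lpa_scaleA a b x : lpa_scale a (lpa_scale b x) = lpa_scale (a * b) x.
Proof. by elim/quotW: x => x; rewrite (lpa_scaleE b) !lpa_scaleE; apply/lpa_piP; apply: LscaleA. Qed.

Lemma lpa_scale1 : left_id 1 lpa_scale.
Proof. by elim/quotW=> x; rewrite lpa_scaleE; apply/lpa_piP; apply: Lscale1. Qed.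

Lemma lpa_scaleDr : right_distributive lpa_scale +%R.
Proof.
move=> a; elim/quotW=> x; elim/quotW=> y.
by rewrite /GRing.add /= lpa_addE !lpa_scaleE lpa_addE; apply/lpa_piP; apply: LscaleDr.
Qed.

Lemma lpa_scaleDl x : {morph lpa_scale^~ x : a b / a + b}.
Proof.
move=> a b; elim/quotW: x => x.
by rewrite !lpa_scaleE [RHS]lpa_addE; apply/lpa_piP; apply: LscaleDl.
Qed.

HB.instance Definition _ := GRing.Zmodule_isLmodule.Build K leavitt
  lpa_scaleA lpa_scale1 lpa_scaleDr lpa_scaleDl.

Lemma lpa_mulA : associative lpa_mul.
Proof.
by elim/quotW=> x; elim/quotW=> y; elim/quotW=> z;
  rewrite (lpa_mulE y z) (lpa_mulE x y) !lpa_mulE; apply/lpa_piP; apply: LmulA.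
Qed.

Lemma lpa_mulDl : left_distributive lpa_mul +%R.
Proof.
elim/quotW=> x; elim/quotW=> y; elim/quotW=> z.
by rewrite [X in lpa_mul X _]lpa_addE !lpa_mulE [RHS]lpa_addE;
  apply/lpa_piP; apply: LmulDl.
Qed.

Lemma lpa_mulDr : right_distributive lpa_mul +%R.
Proof.
elim/quotW=> x; elim/quotW=> y; elim/quotW=> z.
by rewrite [X in lpa_mul _ X]lpa_addE !lpa_mulE [RHS]lpa_addE;
  apply/lpa_piP; apply: LmulDr.
Qed.

Lemma lpa_scaleAl a x y : a *: lpa_mul x y = lpa_mul (a *: x) y.
Proof.
elim/quotW: x => x; elim/quotW: y => y.
rewrite lpa_mulE [LHS]lpa_scaleE [X in lpa_mul X _]lpa_scaleE lpa_mulE.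
apply/lpa_piP; apply: LscaleAl.
Qed.

Lemma lpa_scaleAr a x y : a *: lpa_mul x y = lpa_mul x (a *: y).
Proof.
elim/quotW: x => x; elim/quotW: y => y.
rewrite lpa_mulE [LHS]lpa_scaleE [X in lpa_mul _ X]lpa_scaleE lpa_mulE.
apply/lpa_piP; apply: LscaleAr.
Qed.

Definition lpa_vert (v : vertex G) : leavitt := [LVert v]L.
Definition lpa_edge (e : edge G) : leavitt := [LEdge e]L.
Definition lpa_ghost (e : edge G) : leavitt := [LGhost e]L.

Definition lpa_one : leavitt := \sum_(v : vertex G) lpa_vert v.

Lemma lpa_vertM v w :
  lpa_mul (lpa_vert v) (lpa_vert w) = if v == w then lpa_vert w else 0.
Proof.
rewrite lpa_mulE; have := @Lvv K G v w; case: (v == w) => vw; exact/lpa_piP.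
Qed.

Lemma lpa_mul0l x : lpa_mul 0 x = 0.
Proof. by apply: (addrI (lpa_mul 0 x)); rewrite -lpa_mulDl !addr0. Qed.

Lemma lpa_mul0r x : lpa_mul x 0 = 0.
Proof. by apply: (addrI (lpa_mul x 0)); rewrite -lpa_mulDr !addr0. Qed.

Lemma lpa_mulNl x y : lpa_mul (- x) y = - lpa_mul x y.
Proof. by apply: (addrI (lpa_mul x y)); rewrite -lpa_mulDl !subrr lpa_mul0l. Qed.

Lemma lpa_mulNr x y : lpa_mul x (- y) = - lpa_mul x y.
Proof. by apply: (addrI (lpa_mul x y)); rewrite -lpa_mulDr !subrr lpa_mul0r. Qed.

Lemma lpa_one_vert v : lpa_mul lpa_one (lpa_vert v) = lpa_vert v.
Proof.
rewrite /lpa_one.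
have -> : lpa_mul (\sum_w lpa_vert w) (lpa_vert v)
        = \sum_w lpa_mul (lpa_vert w) (lpa_vert v).
  apply: (big_morph (fun x => lpa_mul x (lpa_vert v))); last exact: lpa_mul0l.
  by move=> x y; exact: lpa_mulDl.
rewrite (bigD1 v) //= lpa_vertM eqxx big1 ?addr0 // => w /negPf wv.
by rewrite lpa_vertM wv.
Qed.

Lemma lpa_vert_one v : lpa_mul (lpa_vert v) lpa_one = lpa_vert v.
Proof.
rewrite /lpa_one.
have -> : lpa_mul (lpa_vert v) (\sum_w lpa_vert w)
        = \sum_w lpa_mul (lpa_vert v) (lpa_vert w).
  apply: (big_morph (lpa_mul (lpa_vert v))); last exact: lpa_mul0r.
  by move=> x y; exact: lpa_mulDr.
rewrite (bigD1 v) //= lpa_vertM eqxx big1 ?addr0 // => w /negPf wv.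
by rewrite lpa_vertM eq_sym wv.
Qed.

Lemma lpa_mul1l : left_id lpa_one lpa_mul.
Proof.
elim/quotW; elim=> [v|e|e||x IH|x IHx y IHy|a x IH|x IHx y IHy].
- exact: lpa_one_vert.
- rewrite -/(lpa_edge e).
  have <- : lpa_mul (lpa_vert (src e)) (lpa_edge e) = lpa_edge e.
    by rewrite lpa_mulE; apply/lpa_piP; apply: Lse.
  by rewrite lpa_mulA lpa_one_vert.
- rewrite -/(lpa_ghost e).
  have <- : lpa_mul (lpa_vert (tgt e)) (lpa_ghost e) = lpa_ghost e.
    by rewrite lpa_mulE; apply/lpa_piP; apply: Lrg.
  by rewrite lpa_mulA lpa_one_vert.
- exact: lpa_mul0r.
- by rewrite -lpa_oppE (lpa_mulNr lpa_one) IH.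
- by rewrite -lpa_addE (lpa_mulDr lpa_one) IHx IHy.
- by rewrite -lpa_scaleE -(lpa_scaleAr a lpa_one) IH.
- by rewrite -lpa_mulE lpa_mulA IHx.
Qed.

Lemma lpa_mul1r : right_id lpa_one lpa_mul.
Proof.
elim/quotW; elim=> [v|e|e||x IH|x IHx y IHy|a x IH|x IHx y IHy].
- exact: lpa_vert_one.
- rewrite -/(lpa_edge e).
  have <- : lpa_mul (lpa_edge e) (lpa_vert (tgt e)) = lpa_edge e.
    by rewrite lpa_mulE; apply/lpa_piP; apply: Ler.
  by rewrite -lpa_mulA lpa_vert_one.
- rewrite -/(lpa_ghost e).
  have <- : lpa_mul (lpa_ghost e) (lpa_vert (src e)) = lpa_ghost e.
    by rewrite lpa_mulE; apply/lpa_piP; apply: Lgs.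
  by rewrite -lpa_mulA lpa_vert_one.
- exact: lpa_mul0l.
- by rewrite -lpa_oppE (lpa_mulNl [x]L) IH.
- by rewrite -lpa_addE (lpa_mulDl [x]L) IHx IHy.
- by rewrite -lpa_scaleE -(lpa_scaleAl a [x]L) IH.
- by rewrite -lpa_mulE -lpa_mulA IHy.
Qed.

HB.instance Definition _ := GRing.Zmodule_isPzRing.Build leavitt
  lpa_mulA lpa_mul1l lpa_mul1r lpa_mulDl lpa_mulDr.

End LeavittPathAlgebra.

(* Main.v *)
(* Not UGN means that R^m is a direct summand of R^n for some m > n.

   If some d : E^0 -> nat, not identically zero, satisfies d(v) = sum_(s(e) = v) d(r(e)) at every
   regular vertex v, then identifying K^d(v) with the direct sum of the K^d(r(e)) gives a
   finite-dimensional unital representation of L_K(E), and comparing ranks gives UGN.  Such a d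
   is the indicator function of an isolated vertex or of a source cycle, and it extends
   across every source elimination.

   Otherwise let x be the sum of the classes of all v L_K(E), so that x is the class of L_K(E)
   itself.  In E_sf, replacing each vertex by the ranges of its edges t times shows that x
   dominates sum_v p_t(v) v, where p_t(v) counts the paths of length t ending at v.  Without
   sources and source cycles every p_t(v) is eventually at least 2, so x dominates 2x, hence all
   multiples of x.  This property lifts from E minus v to E when the source v is not a sink,
   because the relation v = sum r(e) bounds v by vertices that remain. *)
Require Import Defs.
From mathcomp Require Import all_boot all_order all_algebra.
From mathcomp Require Import boolp classical_sets functions cardinality.

Set Implicit Arguments.
Unset Strict Implicit.
Unset Printing Implicit Defensive.

Import GRing.Theory.

(** * Finite labelled families compared fibre by fibre *)

Section LabelledFamilies.

Lemma big_sig_cond (I : finType) (P Q : pred I) (F : I -> nat) :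
  \sum_(i | P i && Q i) F i = \sum_(x : {i | P i} | Q (val x)) F (val x).
Proof.
rewrite (reindex_omap (val : {i | P i} -> I) insub) => [|i /andP[Pi _]]; last by rewrite insubT.
by apply: eq_bigl => x; rewrite valK eqxx andbT (valP x).
Qed.

(** Each fibre of [f] goes into the fibre of [g] over the same label by matching positions in the
    two enumerations. Where the two fibres have equal cardinality the map is onto, which gives the
    last clause. *)
Lemma label_injection (V I J : finType) (f : I -> V) (g : J -> V) :
  (forall v, #|[set i | f i == v]%SET| <= #|[set j | g j == v]%SET|) ->
  exists h : I -> J, [/\ injective h, forall i, g (h i) = f i &
    forall j, #|[set i | f i == g j]%SET| = #|[set j' | g j' == g j]%SET| ->
      exists i, h i = j].
Proof.
move=> le_fg.
pose F v := [set i | f i == v]%SET; pose H v := [set j | g j == v]%SET.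
have /choice[h hP] i : exists j, g j = f i /\
    index j (enum (H (f i))) = index i (enum (F (f i))).
  have lt_i : index i (enum (F (f i))) < size (enum (H (f i))).
    rewrite -cardE; apply: leq_trans (le_fg (f i)); rewrite [X in _ < X]cardE index_mem.
    by rewrite mem_enum inE.
  have [j0 _] : exists j, j \in enum (H (f i)).
    by case: (enum (H (f i))) lt_i => [|j s _]; [rewrite ltn0|exists j; exact: mem_head].
  exists (nth j0 (enum (H (f i))) (index i (enum (F (f i))))); split.
    by have := mem_nth j0 lt_i; rewrite mem_enum inE => /eqP.
  by rewrite index_uniq ?enum_uniq.
have h_inj : injective h.
  move=> i i' hii'; have [gi idxi] := hP i; have [gi' idxi'] := hP i'.
  have fii' : f i = f i' by rewrite -gi -gi' hii'.
  move: idxi; rewrite hii' fii' idxi' => /esym.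
  by move/index_inj => -> //; rewrite mem_enum inE ?fii'.
exists h; split=> // [i|j eq_j]; first by case: (hP i).
have sub : h @: F (g j) \subset H (g j).
  by apply/fintype.subsetP => _ /imsetP[i + ->]; rewrite !inE; case: (hP i) => ->.
have /eqP im : h @: F (g j) == H (g j).
  by rewrite eqEcard sub card_imset //= eq_j.
have : j \in H (g j) by rewrite inE.
by rewrite -im => /imsetP[i _ ->]; exists i.
Qed.

Lemma card_tag_fiber (X V : finType) (n : X -> nat) (f : X -> V) v :
  #|[set i : {x : X & 'I_(n x)} | f (tag i) == v]%SET| = \sum_(x | f x == v) n x.
Proof.
transitivity (\sum_(x | f x == v) \sum_(k : 'I_(n x)) 1).
  by rewrite sig_big_dep -sum1_card; apply: eq_bigl => i; rewrite inE andbT.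
by apply: eq_bigr => x _; rewrite sum1_card card_ord.
Qed.

End LabelledFamilies.

(** * UGN in terms of one-sided inverses of matrices *)

Section UnboundedGeneratingNumber.
Local Open Scope classical_set_scope.
Local Open Scope ring_scope.

Lemma small_set_enum (T : Type) (S : set T) (m : nat) :
  ~ (`I_m #<= S)%card ->
  exists n, (n < m)%N /\ exists h : 'I_n -> T, forall x, S x -> exists t, x = h t.
Proof.
move=> nle; have [[n Sn]|/infiniteP natS] := pselect (finite_set S); last first.
  by case: nle; apply: card_le_trans natS; apply: subset_card_le.
exists n; split.
  rewrite ltnNge; apply: contra_notN nle => mn.
  by rewrite (card_le_eqr Sn) card_le_II.
have /card_set_bijP[f [ffun finj fsurj]] := Sn.
have /choice[h hP] (t : 'I_n) : exists x, S x /\ f x = t.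
  by have [x Sx fx] := fsurj t (ltn_ord t); exists x.
exists h => x Sx.
exists (Ordinal (ffun _ Sx)); have [Sh fh] := hP (Ordinal (ffun _ Sx)).
by apply: finj; rewrite ?inE // fh.
Qed.

(** A generating family of [n] columns is a matrix [A] with a right inverse [B]: the columns of [B]
    express the standard basis vectors in the generators. *)
Lemma UGN_matrixP (R : pzRingType) :
  UGN R <-> forall m n (A : 'M[R]_(m, n)) (B : 'M[R]_(n, m)),
              A *m B = 1%:M -> (m <= n)%N.
Proof.
split=> [ugn m n A B AB1|UR m m_gt0 S genS].
  have [->//|m_gt0] := posnP m.
  (* Columns may coincide, so this set is only known to have at most [n] elements, which is the
     bound wanted. *)
  have gen : right_generates [set` codom (fun j => col j A)].
    move=> x; exists n, (fun j => col j A), (fun j => (B *m x) j 0); split.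
      by move=> j /=; apply: codom_f.
    rewrite -[LHS]mul1mx -AB1 -mulmxA; apply/colP=> i.
    by rewrite summxE mxE; apply: eq_bigr => j _; rewrite !mxE.
  have := ugn m m_gt0 _ gen => /card_le_trans.
  move/(_ _ `I_n); rewrite card_le_II; apply.
  have cod : codom (fun j => col j A) = [seq col j A | j <- enum 'I_n] by [].
  have /card_le_trans -> // : ([set` codom (fun j => col j A)] #<= [set: 'I_n])%card.
    have -> : [set` codom (fun j => col j A)] = (fun j => col j A) @` [set: 'I_n].
      apply/seteqP; split=> x /=; first by case/codomP=> j ->; exists j.
      by case=> j _ <-; apply: codom_f.
    exact: card_image_le.
  by rewrite -(card_le_eql card_II).
apply: contrapT => /small_set_enum[n [nm [h hS]]].
have /choice[B BP] (k : 'I_m) : exists b : 'I_n -> R,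
    delta_mx k 0 = \sum_t rscale (h t) (b t).
  have [r [g [a [Sg ->]]]] := genS (delta_mx k 0).
  have /choice[t ht] j : exists t, g j = h t by exact: hS.
  (* A generator may occur several times in the expression; its coefficients are added up. *)
  exists (fun u => \sum_(j | t j == u) a j).
  rewrite (partition_big t xpredT) //=; apply: eq_bigr => u _.
  apply/colP=> i; rewrite summxE mxE mulr_sumr; apply: eq_bigr => j /eqP tj.
  by rewrite mxE ht tj.
have := UR m n (\matrix_(i, j) h j i 0) (\matrix_(j, k) B k j).
rewrite leqNgt nm => H; suff : false by []; apply: H.
apply/matrixP=> i k; have := BP k => /colP/(_ i); rewrite summxE !mxE eqxx andbT => ->.
by apply: eq_bigr => j _; rewrite !mxE.
Qed.

(** Applied entrywise, [phi] turns [A *m B = 1%:M] into an identity of block matrices over a field,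
    where ranks give [m * N <= n * N]. *)
Lemma UGN_matrix_rep (R : pzRingType) (K : fieldType) (N : nat)
    (phi : R -> 'M[K]_N) :
  (0 < N)%N -> phi 0 = 0 -> {morph phi : x y / x + y >-> x + y} ->
  {morph phi : x y / x * y >-> x *m y} -> phi 1 = 1%:M -> UGN R.
Proof.
move=> N_gt0 phi0 phiD phiM phi1; apply/UGN_matrixP => m n A B AB1.
pose blk p q (C : 'M[R]_(p, q)) :=
  \mxblock_(i < p, j < q) phi (C i j) : 'M[K]_(\sum_(_ < p) N, \sum_(_ < q) N).
have blk1 : blk _ _ A *m blk _ _ B = 1%:M.
  rewrite mul_mxblock -mxdiagZ; apply: eq_mxblock => i k.
  have /matrixP/(_ i k) := AB1; rewrite !mxE => /(congr1 phi).
  rewrite (big_morph phi phiD phi0) => ABik.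
  transitivity (\sum_j phi (A i j * B j k)); first by apply: eq_bigr => j _; rewrite phiM.
  by rewrite ABik; case: eqVneq => _; rewrite ?phi1 ?conform_mx_id ?phi0.
have := mxrankM_maxl (blk _ _ A) (blk _ _ B); rewrite blk1 mxrank1 => le.
have := leq_trans le (rank_leq_col _); rewrite !sum_nat_const !card_ord.
by rewrite leq_pmul2r.
Qed.
End UnboundedGeneratingNumber.

(** * Balanced functions and branching systems *)

Section Balanced.
Variable G : digraph.

(** Such functions are the homomorphisms from the graph monoid of [G] to the natural numbers. *)
Definition balanced (d : vertex G -> nat) : Prop :=
  forall w, regular_vertex w -> d w = \sum_(e in out_edges w) d (tgt e).

(* The index type 'I_N carries a disjoint family of fibres of lam; sigma e sends the fibre over
   tgt e injectively into the fibre over src e, and the images of the edges leaving a regular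
   vertex partition its fibre. *)
Definition branching (N : nat) (lam : 'I_N -> vertex G)
    (sigma : edge G -> 'I_N -> 'I_N) : Prop :=
  [/\ forall e i, lam i = tgt e -> lam (sigma e i) = src e,
      forall e f i j, lam i = tgt e -> lam j = tgt f ->
        sigma e i = sigma f j -> e = f /\ i = j &
      forall i, regular_vertex (lam i) ->
        exists e j, [/\ src e = lam i, lam j = tgt e & i = sigma e j]].

(** Take [d v] indices over each [v], and let [P] consist of the pairs of an edge and an index over
    its range. Over a regular vertex, balance gives as many pairs as indices; over a sink there are
    no pairs. So [label_injection] embeds [P] into the indices, onto the fibres of regular
    vertices. *)
Lemma balanced_branching (d : vertex G -> nat) (v0 : vertex G) :
  balanced d -> (0 < d v0)%N ->
  exists N (lam : 'I_N -> vertex G) (sigma : edge G -> 'I_N -> 'I_N),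
    (0 < N)%N /\ branching lam sigma.
Proof.
move=> bal dv0; pose B := {v : vertex G & 'I_(d v)}.
pose lam (i : 'I_#|{: B}|) := tag (enum_val i : B).
have card_lam v : #|[set i | lam i == v]%SET| = d v.
  rewrite -(card_imset _ enum_val_inj).
  transitivity #|[set b : B | tag b == v]%SET|; last first.
    by rewrite (card_tag_fiber d id) big_pred1_eq.
  apply: eq_card => b; apply/imsetP/idP => [[i + ->]|]; rewrite !inE //.
  by exists (enum_rank b); rewrite ?inE /lam enum_rankK.
pose P := {p : edge G * 'I_#|{: B}| | lam p.2 == tgt p.1}.
have card_P w : #|[set p : P | src (val p).1 == w]%SET| = \sum_(e in out_edges w) d (tgt e).
  transitivity (\sum_(e in out_edges w) \sum_(i | lam i == tgt e) 1).
    rewrite pair_big_dep -sum1_card (eq_bigl (fun p : edge G * 'I_#|{: B}| =>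
      (lam p.2 == tgt p.1) && (src p.1 == w))) => [|p]; last by rewrite inE andbC.
    by rewrite big_sig_cond; apply: eq_bigl => p; rewrite inE.
  by apply: eq_bigr => e _; rewrite -card_lam -sum1_card; apply: eq_bigl => i; rewrite inE.
have [w|h [h_inj lam_h h_surj]] :=
    @label_injection _ P _ (fun p => src (val p).1) lam.
  rewrite card_P card_lam; have [reg|] := boolP (regular_vertex w); first by rewrite bal.
  by rewrite /regular_vertex card_gt0 negbK => /eqP ->; rewrite big_set0.
(* The default [i] is a junk value: [branching] constrains [sigma e i] only for [i] over [tgt e]. *)
pose sigma e i := if insub (e, i) is Some p then h p else i.
have sigmaE e i (le : lam i == tgt e) : sigma e i = h (exist _ (e, i) le).
  by rewrite /sigma insubT.
exists #|{: B}|, lam, sigma; split.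
  by apply/card_gt0P; exists (Tagged (fun v => 'I_(d v)) (Ordinal dv0)).
split=> [e i /eqP le|e f i j /eqP ei /eqP fj|i reg].
- by rewrite (sigmaE _ _ le) lam_h.
- by rewrite (sigmaE _ _ ei) (sigmaE _ _ fj) => /h_inj/(congr1 val) [-> ->].
- have [|[[e j] le] hi] := h_surj i; first by rewrite card_P card_lam bal.
  exists e, j; split; [|exact/eqP|by rewrite (sigmaE _ _ le) hi].
  by rewrite -hi lam_h.
Qed.
End Balanced.

(** * The matrix representation attached to a branching system *)

Section Representation.
Local Open Scope ring_scope.
Variables (K : fieldType) (G : digraph) (N : nat).
Variables (lam : 'I_N -> vertex G) (sigma : edge G -> 'I_N -> 'I_N).
Hypothesis br : branching lam sigma.

Definition vertex_mx (v : vertex G) : 'M[K]_N := diag_mx (\row_i (lam i == v)%:R).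
(** The basis vector [j] over [tgt e] goes to the basis vector [sigma e j], all others to zero. This
    is a partial permutation, so its transpose is its partial inverse and can represent the ghost
    edge. *)
Definition edge_mx (e : edge G) : 'M[K]_N :=
  \matrix_(i, j) ((lam j == tgt e) && (i == sigma e j))%:R.

Fixpoint lpa_eval (t : lpa_term K G) : 'M[K]_N :=
  match t with
  | LVert v => vertex_mx v
  | LEdge e => edge_mx e
  | LGhost e => (edge_mx e)^T
  | LZero => 0
  | LOpp x => - lpa_eval x
  | LAdd x y => lpa_eval x + lpa_eval y
  | LScale a x => a *: lpa_eval x
  | LMul x y => lpa_eval x *m lpa_eval y
  end.

Lemma vertex_mxM v w : vertex_mx v *m vertex_mx w = if v == w then vertex_mx w else 0.
Proof.
rewrite mul_diag_mx; apply/matrixP=> i j; rewrite !mxE.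
have [->|vw] := eqVneq v w; rewrite !mxE.
  by case: (lam i == w); rewrite ?mul1r ?mul0r // mul0rn.
by case: (eqVneq (lam i) v) => [->|_]; rewrite ?mul0r // (negPf vw) mul0rn mulr0.
Qed.

Lemma src_edge_mx e : vertex_mx (src e) *m edge_mx e = edge_mx e.
Proof.
case: br => br1 _ _; rewrite mul_diag_mx; apply/matrixP=> i j; rewrite !mxE.
have [lj|_] := eqVneq (lam j) (tgt e); last by rewrite mulr0.
have [->|_] := eqVneq i (sigma e j); last by rewrite mulr0.
by rewrite br1 // eqxx mulr1.
Qed.

Lemma edge_mx_tgt e : edge_mx e *m vertex_mx (tgt e) = edge_mx e.
Proof.
rewrite mul_mx_diag; apply/matrixP=> i j; rewrite !mxE.
by case: (lam j == tgt e); rewrite ?mulr1 ?mul0r.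
Qed.

Lemma ghost_edge_mx e f :
  (edge_mx e)^T *m edge_mx f = if e == f then vertex_mx (tgt e) else 0.
Proof.
case: br => _ br2 _; apply/matrixP=> i j; rewrite !mxE (bigD1 (sigma e i)) //= !mxE eqxx.
rewrite big1 => [|k /negPf ki]; last by rewrite !mxE ki andbF mul0r.
rewrite addr0 andbT -natrM mulnb.
have [ie|ie] := eqVneq (lam i) (tgt e); last first.
  by case: (e == f); rewrite !mxE ?(negPf ie) ?mul0rn.
have [jf|jf] := eqVneq (lam j) (tgt f); last first.
  have [ef|_] := eqVneq e f; rewrite !mxE //.
  by have [ij|//] := eqVneq i j; rewrite -ij -ef ie eqxx in jf.
have [|nij] := eqVneq (sigma e i) (sigma f j).
  by case/(br2 _ _ _ _ ie jf) => <- <-; rewrite eqxx !mxE ie !eqxx.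
have [ef|_] := eqVneq e f; rewrite !mxE //.
by have [ij|//] := eqVneq i j; rewrite -ij -ef eqxx in nij.
Qed.

(** Each summand is the diagonal projection onto the image of [sigma e], and these images partition
    the fibre over [v]. *)
Lemma edge_mx_ghost v : regular_vertex v ->
  vertex_mx v = \sum_(e in out_edges v) edge_mx e *m (edge_mx e)^T.
Proof.
case: br => br1 br2 br3 reg; apply/matrixP=> i j; rewrite summxE !mxE.
have [iv|iv] := eqVneq (lam i) v; last first.
  rewrite mul0rn big1 // => e; rewrite inE => /eqP ev.
  rewrite mxE big1 // => k _; rewrite !mxE.
  have [ke|_] := eqVneq (lam k) (tgt e); last by rewrite mul0r.
  have [ik|_] := eqVneq i (sigma e k); last by rewrite mul0r.
  by rewrite ik br1 // ev eqxx in iv.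
have [|e [k [ei ke ->]]] := br3 i; first by rewrite iv.
rewrite (bigD1 e) /=; last by rewrite inE ei iv.
rewrite mxE (bigD1 k) //= !mxE ke !eqxx mul1r !big1 ?addr0 1?eq_sym //.
- by move=> f /andP[_ fe]; rewrite mxE big1 // => m _; rewrite !mxE;
    have [mf|_] := eqVneq (lam m) (tgt f); rewrite ?mul0r //;
    have [/(br2 _ _ _ _ ke mf)[ef _]|_] := eqVneq (sigma e k) (sigma f m);
    rewrite ?mul0r // ef eqxx in fe *.
- by move=> m mk; rewrite !mxE; have [me|_] := eqVneq (lam m) (tgt e); rewrite ?mul0r //;
    have [/(br2 _ _ _ _ ke me)[_ km]|_] := eqVneq (sigma e k) (sigma e m);
    rewrite ?mul0r // km eqxx in mk *.
Qed.

Lemma lpa_eval_eq x y : lpa_eq x y -> lpa_eval x = lpa_eval y.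
Proof.
elim=> //=.
- by move=> ? ? ? _ -> _ ->.
- by move=> ? ? _ ->.
- by move=> ? ? ? ? _ -> _ ->.
- by move=> ? ? ? _ ->.
- by move=> ? ? ? ? _ -> _ ->.
- by move=> *; rewrite addrA.
- by move=> *; rewrite addrC.
- by move=> *; rewrite add0r.
- by move=> *; rewrite addNr.
- by move=> *; rewrite scalerA.
- by move=> *; rewrite scale1r.
- by move=> *; rewrite scalerDr.
- by move=> *; rewrite scalerDl.
- by move=> *; rewrite mulmxA.
- by move=> *; rewrite mulmxDl.
- by move=> *; rewrite mulmxDr.
- by move=> *; rewrite scalemxAl.
- by move=> *; rewrite scalemxAr.
- by move=> v w; rewrite vertex_mxM; case: ifP.
- exact: src_edge_mx.
- exact: edge_mx_tgt.
- by move=> e; rewrite -[vertex_mx _]tr_diag_mx -trmx_mul edge_mx_tgt.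
- by move=> e; rewrite -[vertex_mx _]tr_diag_mx -trmx_mul src_edge_mx.
- by move=> e f; rewrite ghost_edge_mx; case: ifP.
- move=> v /edge_mx_ghost ->; symmetry.
  exact: (big_morph lpa_eval (id1 := 0) (op1 := +%R)).
Qed.

Definition leavitt_rep (x : leavitt K G) : 'M[K]_N := lpa_eval (repr x).

Lemma leavitt_repE (x : lpa_term K G) : leavitt_rep (\pi_(leavitt K G) x)%qT = lpa_eval x.
Proof. exact/lpa_eval_eq/lpa_repr. Qed.

Lemma leavitt_repD : {morph leavitt_rep : x y / x + y}.
Proof. by move=> x y; rewrite [X in leavitt_rep X]/(lpa_add x y) leavitt_repE. Qed.

Lemma leavitt_rep0 : leavitt_rep 0 = 0.
Proof. by apply: (addrI (leavitt_rep 0)); rewrite -leavitt_repD !addr0. Qed.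

Lemma leavitt_repM : {morph leavitt_rep : x y / x * y >-> x *m y}.
Proof. by move=> x y; rewrite [X in leavitt_rep X]/(lpa_mul x y) leavitt_repE. Qed.

Lemma leavitt_rep1 : leavitt_rep 1 = 1%:M.
Proof.
rewrite [X in leavitt_rep X]/(lpa_one K G) /lpa_one.
rewrite (big_morph _ leavitt_repD leavitt_rep0).
apply/matrixP=> i j; rewrite summxE (bigD1 (lam i)) //= big1 => [|v vi].
  by rewrite addr0 leavitt_repE !mxE eqxx.
by rewrite leavitt_repE !mxE eq_sym (negPf vi) mul0rn.
Qed.
End Representation.

Lemma UGN_of_balanced (K : fieldType) (G : digraph) (d : vertex G -> nat) v0 :
  balanced d -> (0 < d v0)%N -> UGN (leavitt K G).
Proof.
move=> bal /(balanced_branching bal)[N [lam [sigma [N0 br]]]].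
apply: (@UGN_matrix_rep _ K N (leavitt_rep lam sigma)) => //.
- exact: leavitt_rep0.
- exact: leavitt_repD.
- exact: leavitt_repM.
- exact: leavitt_rep1.
Qed.

(** * Sources of balanced functions, and their extension across source eliminations *)

Section ExistenceOfBalanced.

Definition has_balanced (G : digraph) : Prop :=
  exists (d : vertex G -> nat) v, balanced d /\ (0 < d v)%N.

Lemma isolated_balanced (G : digraph) : has_isolated_vertex G -> has_balanced G.
Proof.
case=> v /andP[/eqP src_v /eqP sink_v]; exists (fun w => w == v), v; split; last by rewrite eqxx.
move=> w reg; rewrite big1 => [|e _].
  by case: eqVneq reg => // ->; rewrite /regular_vertex sink_v cards0.
by move/setP/(_ e): src_v; rewrite !inE => ->.
Qed.

(** Since in-degrees on the cycle are one, an edge ending on the cycle belongs to it. The sum at [w]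
    thus counts the cycle edges leaving [w]: one if [w] is on the cycle, none otherwise. *)
Lemma source_cycle_balanced (G : digraph) : has_source_cycle G -> has_balanced G.
Proof.
case=> p /andP[/andP[/andP[p_gt0 cyc] uniq_p] /allP indeg1].
have tgt_p e : (tgt e \in map (@src G) p) = (e \in p).
  apply/mapP/idP => [[f fp ef]|ep]; last first.
    by exists (next p e); [rewrite mem_next|apply/eqP; exact: next_cycle cyc ep].
  have /cards1P[g ing] := indeg1 _ (map_f _ fp).
  have: e \in in_edges (src f) by rewrite inE ef.
  have: prev p f \in in_edges (src f) by rewrite inE; exact: prev_cycle cyc fp.
  by rewrite ing !inE => /eqP <- /eqP ->; rewrite mem_prev.
exists (fun w => w \in map (@src G) p).
have [e0 e0p] : exists e, e \in p by case: (p) p_gt0 => // e q _; exists e; exact: mem_head.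
exists (src e0); split; last by rewrite map_f.
move=> w _; under eq_bigr => e do rewrite tgt_p.
rewrite -count_uniq_mem // count_map -big_mkcondr sum1_card.
rewrite -size_filter -(card_uniqP _) ?filter_uniq ?(map_uniq uniq_p) //.
by apply: eq_card => e; rewrite mem_filter unfold_in !inE.
Qed.

Section SourceElimination.
Variables (G : digraph) (v : vertex G) (hv : is_source v).
Let H := source_elim hv.

Definition extend (d0 : nat) (a : vertex H -> nat) : vertex G -> nat :=
  fun w => oapp a d0 (insub w).

Lemma extend_val d0 (a : vertex H -> nat) (u : vertex H) : extend d0 a (val u) = a u.
Proof. by rewrite /extend valK. Qed.

Lemma extend_source d0 (a : vertex H -> nat) : extend d0 a v = d0.
Proof. by rewrite /extend insubF ?eqxx. Qed.

Lemma extendP (T : Prop) (w : vertex G) :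
  (w = v -> T) -> (forall u : vertex H, w = val u -> T) -> T.
Proof.
move=> Tv Tu; have [/Tv//|wv] := eqVneq w v; exact: (Tu (exist _ w wv)).
Qed.

Lemma sum_out_elim (F : edge G -> nat) (u : vertex H) :
  \sum_(e in out_edges (val u)) F e = \sum_(e in out_edges u) F (val e).
Proof.
rewrite (eq_bigl (fun e => (src e != v) && (src e == val u))) => [|e]; last first.
  by rewrite inE andbC; case: eqVneq => // ->; rewrite (valP u).
by rewrite big_sig_cond; apply: eq_bigl => e; rewrite inE.
Qed.

Lemma is_sink_elim (u : vertex H) : is_sink (val u) = is_sink u.
Proof.
by rewrite /is_sink -!cards_eq0 -!sum1_card (sum_out_elim (fun => 1)).
Qed.

Lemma extend_tgt d0 (a : vertex H -> nat) (e : edge H) :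
  extend d0 a (tgt (val e)) = a (tgt e).
Proof. exact: (extend_val d0 a (tgt e)). Qed.

Lemma extend_src d0 (a : vertex H -> nat) (e : edge H) :
  extend d0 a (src (val e)) = a (src e).
Proof. exact: (extend_val d0 a (src e)). Qed.

Lemma source_elim_balanced : has_balanced H -> has_balanced G.
Proof.
case=> d [u [bal du]].
(* Balance at [v] dictates this value. No edge ends at [v], so the equations at the other vertices
   do not see it. *)
pose d0 := \sum_(e in out_edges v) extend 0 d (tgt e).
exists (extend d0 d), (val u); split; last by rewrite extend_val.
move=> w; apply: (extendP (w := w)) => [-> _|{du}u' ->].
  rewrite extend_source; apply: eq_bigr => e _.
  by apply: (extendP (w := tgt e)) => [ev|u' ->]; rewrite ?extend_val //;
    have := source_tgt hv e; rewrite ev eqxx.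
rewrite /regular_vertex card_gt0 -/(is_sink _) is_sink_elim => reg.
rewrite extend_val bal ?/regular_vertex ?card_gt0 // sum_out_elim.
by apply: eq_bigr => e _; rewrite extend_tgt.
Qed.
End SourceElimination.

Lemma elim_step_balanced (G H : digraph) : elim_step G H -> has_balanced H -> has_balanced G.
Proof. by case=> // v hv _; exact: source_elim_balanced. Qed.

End ExistenceOfBalanced.

(** * Domination between multiplicity functions *)

Section Domination.

(** The transposed adjacency matrix applied to [a]: every copy of a vertex is replaced by the ranges
    of its outgoing edges. *)
Definition push (G : digraph) (a : vertex G -> nat) : vertex G -> nat :=
  fun w => \sum_(e in in_edges w) a (src e).

(* a : vertex G -> nat stands for the projective right module sum_v (v L_K(G))^(a v);
   dominated a b implies that the module of a is a direct summand of that of b. *)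
Inductive dominated (G : digraph) : (vertex G -> nat) -> (vertex G -> nat) -> Prop :=
| DomLeq a b : (forall v, a v <= b v) -> dominated a b
| DomTrans a b c : dominated a b -> dominated b c -> dominated a c
| DomPush a : dominated (push a) a
| DomExpand a : dominated a (fun v => push a v + a v * is_sink v).

(** The constant function [k] stands for the free module of rank [k], because the algebra is the
    direct sum of its modules generated by vertices. *)
Definition collapses (G : digraph) : Prop :=
  forall k, dominated (fun _ : vertex G => k) (fun _ => 1).

Lemma push_source (G : digraph) (a : vertex G -> nat) v : is_source v -> push a v = 0.
Proof. by move=> /eqP hv; rewrite /push hv big_set0. Qed.

Section SourceElimination.
Variables (G : digraph) (v : vertex G) (hv : is_source v).
Let H := source_elim hv.
Local Notation ext := (@extend G v hv 0).

Lemma push_extend (a : vertex H -> nat) : push (ext a) = ext (push a).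
Proof.
apply: funext => w; apply: (extendP (hv := hv) (w := w)) => [->|u ->].
  by rewrite push_source // extend_source.
rewrite extend_val /push.
rewrite (bigID (fun e => src e != v)) /= addnC big1 ?add0n => [|e /andP[_]]; last first.
  by rewrite negbK => /eqP ->; rewrite extend_source.
under eq_bigl do rewrite andbC.
rewrite big_sig_cond; apply: eq_big => [e|e _]; first by rewrite !inE.
exact: (extend_src 0 a (e : edge H)).
Qed.

Lemma dominated_extend (a b : vertex H -> nat) :
  dominated a b -> dominated (ext a) (ext b).
Proof.
elim=> {a b} [a b ab|a b c _ ab _ bc|a|a].
- apply: DomLeq => w; apply: (extendP (hv := hv) (w := w)) => [->|u ->].
    by rewrite !extend_source.
  by rewrite !extend_val.
- exact: DomTrans ab bc.
- by rewrite -push_extend; apply: DomPush.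
- apply: DomTrans (DomExpand _) (DomLeq _) => w; rewrite push_extend.
  apply: (extendP (hv := hv) (w := w)) => [->|u ->]; first by rewrite !extend_source.
  by rewrite !extend_val is_sink_elim.
Qed.

(** One expansion removes [v]: nothing is pushed into a source, and a non-sink is not retained. What
    is left lives on the smaller graph, where any constant collapses to 1. *)
Lemma source_elim_collapses : ~~ is_sink v -> collapses H -> collapses G.
Proof.
move=> /negPf vsink colH k.
pose b (w : vertex G) := push (fun=> k) w + k * is_sink w.
apply: DomTrans (DomExpand _) _.
apply: (@DomTrans _ _ (ext (fun=> \sum_w b w))).
  apply: DomLeq => w; apply: (extendP (hv := hv) (w := w)) => [->|u ->].
    by rewrite /b push_source // vsink muln0.
  by rewrite extend_val [leqRHS](bigD1 (val u)) //= leq_addr.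
apply: DomTrans (dominated_extend (colH _)) (DomLeq _) => w.
by apply: (extendP (hv := hv) (w := w)) => [->|u ->]; rewrite ?extend_source ?extend_val.
Qed.
End SourceElimination.

(** * Counting paths in a source-free graph *)

Section SourceFree.
Variables (G : digraph) (sf : source_free G).

(** The number of paths of length [t] ending at a given vertex. *)
Definition npaths (t : nat) : vertex G -> nat := iter t (@push G) (fun=> 1).

Lemma npathsS t w : npaths t.+1 w = \sum_(e in in_edges w) npaths t (src e).
Proof. by []. Qed.

Lemma npaths_mono t w : npaths t w <= npaths t.+1 w.
Proof.
elim: t w => [|t IHt] w; rewrite npathsS; last by rewrite npathsS; apply: leq_sum.
by rewrite sum1_card card_gt0 sf.
Qed.

Lemma npaths_leq s t w : s <= t -> npaths s w <= npaths t w.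
Proof.
by move=> st; apply: (homo_leq (f := npaths^~ w) (@leqnn) (@leq_trans)) st => i; exact: npaths_mono.
Qed.

Lemma iter_push_const c t w : iter t (@push G) (fun=> c) w = c * npaths t w.
Proof.
elim: t w => [|t IHt] w; first by rewrite muln1.
by rewrite iterS [LHS]/push npathsS big_distrr; apply: eq_bigr => e _; rewrite IHt.
Qed.

Lemma dominated_iter_push a t : dominated (iter t (@push G) a) a.
Proof.
elim: t => [|t IHt]; first exact: DomLeq.
exact: DomTrans (DomPush _) IHt.
Qed.

(** If the count at [v] is always 1, then [v] has a single incoming edge, whose source inherits the
    property. Walking backwards in a finite graph eventually loops, and the loop is a source
    cycle. *)
Lemma npaths_unbounded_or_source_cycle v :
  (exists t, 1 < npaths t v) \/ has_source_cycle G.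
Proof.
have [|nex] := pselect (exists t, 1 < npaths t v); [by left|right].
pose S w := forall t, npaths t w = 1.
have Sv : S v.
  move=> t; apply/eqP; rewrite eqn_leq (npaths_leq v (leq0n t)) andbT leqNgt.
  by apply: contra_notN nex => ?; exists t.
have /choice[pi piP] w : exists e : edge G, tgt e = w.
  by have /set0Pn[e] := sf w; rewrite inE => /eqP; exists e.
pose g w := src (pi w).
have S1 w : S w -> in_edges w = [set pi w]%SET.
  move=> /(_ 1); rewrite npathsS sum1_card => /eqP/cards1P[e ein].
  have: pi w \in in_edges w by rewrite inE piP.
  by rewrite ein inE => /eqP <-.
have Sg w : S w -> S (g w).
  by move=> Sw t; rewrite -(Sw t.+1) npathsS (S1 _ Sw) big_set1.
have Sit w n : S w -> S (iter n g w) by move=> Sw; elim: n => //= n; exact: Sg.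
have [i lt_i iter_i] := trajectP (looping_order g v).
pose u := iter i g v.
(* The walk from [v] returns to [u] after [order g v - i] steps, so [u] is periodic and [g] is
   injective on its orbit. *)
have cyc_u : fcycle g (orbit g u).
  apply/(orbitPcycle 0 3); exists (order g v - i).-1.
  by rewrite prednK ?subn_gt0 // /u -iterD subnK // ltnW.
have inj_u := (orbitPcycle 0 5).1 cyc_u.
have Su w : w \in orbit g u -> S w by case/trajectP => j _ ->; exact/Sit/Sit.
have gu w : w \in orbit g u -> g w \in orbit g u.
  by rewrite -!fconnect_orbit => /connect_trans; apply; exact: fconnect1.
(* [g] runs against the edges, hence the reversal. *)
exists (rev (map pi (orbit g u))); apply/andP; split; [apply/andP; split; [apply/andP; split|]|].
- by rewrite size_rev size_map size_orbit order_gt0.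
- rewrite rev_cycle cycle_map; rewrite (eq_cycle (e' := frel g)) // => x y /=.
  by rewrite piP eq_sym.
- by rewrite map_rev rev_uniq -map_comp map_inj_in_uniq ?orbit_uniq.
- rewrite map_rev all_rev -map_comp all_map; apply/allP => w /gu /Su gw /=.
  by rewrite -/(g w) S1 // cards1.
Qed.

Lemma source_free_collapses : ~ has_source_cycle G -> collapses G.
Proof.
move=> nsc; have /choice[t tP] v : exists t, 1 < npaths t v.
  by case: (npaths_unbounded_or_source_cycle v).
pose T := \max_v t v.
(* Pushing the constant [c] forward [T] times leaves [c] times the path count, and [T] makes every
   count at least 2. *)
have dbl c : dominated (fun _ : vertex G => 2 * c) (fun=> c).
  apply: DomTrans (DomLeq _) (dominated_iter_push (fun=> c) T) => w.
  rewrite iter_push_const mulnC leq_mul2l (leq_trans (tP w)) ?orbT //.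
  exact/npaths_leq/leq_bigmax.
move=> k; apply: (@DomTrans _ _ (fun=> 2 ^ k)); first by apply: DomLeq => _; exact/ltnW/ltn_expl.
elim: k => [|k IHk]; first exact: DomLeq.
by apply: DomTrans IHk; rewrite expnS; exact: dbl.
Qed.
End SourceFree.
End Domination.

(** * From domination to direct summands over the Leavitt path algebra *)

Section Retracts.
Local Open Scope ring_scope.
Variables (K : fieldType) (G : digraph).
Local Notation L := (leavitt K G).
Local Notation vert := (@lpa_vert K G : vertex G -> L).
Local Notation edg := (@lpa_edge K G : edge G -> L).
Local Notation ghost := (@lpa_ghost K G : edge G -> L).

Let vertM v w : vert v * vert w = if v == w then vert w else 0.
Proof. exact: lpa_vertM. Qed.

Let one_sum : 1 = \sum_v vert v.
Proof. by []. Qed.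

Let src_edg e : vert (src e) * edg e = edg e.
Proof. by rewrite [LHS]lpa_mulE; apply/lpa_piP/Lse. Qed.

Let edg_tgt e : edg e * vert (tgt e) = edg e.
Proof. by rewrite [LHS]lpa_mulE; apply/lpa_piP/Ler. Qed.

Let ghost_edg e f : ghost e * edg f = if e == f then vert (tgt e) else 0.
Proof. by rewrite [LHS]lpa_mulE; have := @Lge K G e f; case: ifP => _ /lpa_piP. Qed.

Let vert_ck v : regular_vertex v -> vert v = \sum_(e in out_edges v) edg e * ghost e.
Proof.
move=> reg; transitivity (\pi_L (\big[@LAdd K G/LZero]_(e in out_edges v)
    LMul (LEdge e) (LGhost e)))%qT; first exact/lpa_piP/Lck.
rewrite (big_morph (fun x => \pi_L x)%qT (id1 := 0) (op1 := +%R)) //.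
  by apply: eq_bigr => e _; rewrite -lpa_mulE.
by move=> x y; rewrite -lpa_addE.
Qed.

(* (+)_i f(i) L is a direct summand of (+)_j g(j) L. *)
Definition retract (I J : finType) (f : I -> vertex G) (g : J -> vertex G) : Prop :=
  exists (A : I -> J -> L) (B : J -> I -> L),
    forall i i', \sum_j A i j * vert (g j) * B j i' = if i == i' then vert (f i) else 0.

Lemma retract_trans (I J H : finType) (f : I -> vertex G) (g : J -> vertex G)
    (h : H -> vertex G) : retract f g -> retract g h -> retract f h.
Proof.
case=> A [B AB] [C [D CD]].
exists (fun i k => \sum_j A i j * C j k), (fun k i => \sum_j D k j * B j i) => i i'.
under eq_bigr => k _ do rewrite -mulrA mulr_suml.
rewrite exchange_big /= -AB; apply: eq_bigr => j _.
transitivity (\sum_j' A i j * (\sum_k C j k * vert (h k) * D k j') * B j' i').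
  under eq_bigr => k _ do rewrite -mulrA !mulr_sumr.
  rewrite exchange_big; apply: eq_bigr => j' _.
  by rewrite mulr_sumr mulr_suml; apply: eq_bigr => k _; rewrite !mulrA.
under eq_bigr => j' _ do rewrite CD.
rewrite (bigD1 j) //= eqxx big1 ?addr0 // => j' /negPf.
by rewrite eq_sym => ->; rewrite mulr0 mul0r.
Qed.

Lemma retract_injection (I J : finType) (f : I -> vertex G) (g : J -> vertex G)
    (h : I -> J) : injective h -> (forall i, g (h i) = f i) -> retract f g.
Proof.
move=> h_inj gh; exists (fun i j => (h i == j)%:R), (fun j i => (h i == j)%:R) => i i'.
rewrite (bigD1 (h i)) //= eqxx mul1r big1 => [|j /negPf]; last first.
  by rewrite eq_sym => ->; rewrite !mul0r.
by rewrite addr0 gh eq_sym (inj_eq h_inj); case: eqP; rewrite ?mulr1 ?mulr0.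
Qed.

Lemma retract_count (I J : finType) (f : I -> vertex G) (g : J -> vertex G) :
  (forall v, #|[set i | f i == v]%SET| <= #|[set j | g j == v]%SET|)%N -> retract f g.
Proof. by case/label_injection => h [h_inj gh _]; exact: retract_injection h_inj gh. Qed.

Section Correspondence.
Variables (a : vertex G -> nat) (X : finType) (base label : X -> vertex G).
Variables (al be : X -> L).
Let fam : finType := {v : vertex G & 'I_(a v)}.
Let famX : finType := {x : X & 'I_(a (base x))}.
Let down (p : famX) : fam := Tagged (fun v => 'I_(a v)) (tagged p).

(** Left multiplication by [al x] and [be x] maps between the modules of [label x] and [base x]. The
    hypothesis splits each vertex over its labels, and the splitting is repeated for each copy of
    the vertex; [down] recalls which copy. *)
Lemma retract_expand :
  (forall v, \sum_(x | base x == v) al x * vert (label x) * be x = vert v) ->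
  retract (fun i : fam => tag i) (fun p : famX => label (tag p)).
Proof.
move=> sum_v.
exists (fun i p => if down p == i then al (tag p) else 0),
       (fun p i => if down p == i then be (tag p) else 0) => i i'.
have [<-|ii'] := eqVneq i i'; last first.
  rewrite big1 // => p _; case: eqP => [->|_]; last by rewrite !mul0r.
  by rewrite (negPf ii') mulr0.
transitivity (\sum_(p : famX | down p == i) al (tag p) * vert (label (tag p)) * be (tag p)).
  by rewrite [RHS]big_mkcond; apply: eq_bigr => p _; case: ifP; rewrite ?mul0r.
rewrite -sum_v; case: i => v k /=.
(* The condition on the base follows from the other one; stating it lets the sum split over [x]
   first and over the copies next. *)
rewrite (eq_bigl (fun p : famX => (base (tag p) == v) && (down p == Tagged (fun v => 'I_(a v)) k)))
  => [|p]; last first.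
  by apply/idP/andP => [|[]//] H; split=> //; move/eqP: H => /(congr1 tag) /= ->.
rewrite -(sig_big_dep (fun x => base x == v)
  (fun x (m : 'I_(a (base x))) => Tagged (fun v => 'I_(a v)) m == Tagged (fun v => 'I_(a v)) k)
  (fun x m => al x * vert (label x) * be x)).
apply: eq_bigr => x /eqP xv; subst v.
rewrite (eq_bigl (pred1 k)) ?big_pred1_eq // => m.
by rewrite eq_Tagged.
Qed.

(** The composite in the other order: orthogonality within each base vertex makes it the identity on
    the labels. *)
Lemma retract_push :
  (forall x y, base x = base y ->
     be x * vert (base x) * al y = if x == y then vert (label x) else 0) ->
  retract (fun p : famX => label (tag p)) (fun i : fam => tag i).
Proof.
move=> ortho.
exists (fun p i => if down p == i then be (tag p) else 0),
       (fun i p => if down p == i then al (tag p) else 0) => p q.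
rewrite (bigD1 (down p)) //= eqxx big1 => [|i /negPf]; last first.
  by rewrite eq_sym => ->; rewrite !mul0r.
rewrite addr0; have [<-|pq] := eqVneq p q; first by rewrite eqxx ortho // eqxx.
case: eqP => [dpq|_]; last by rewrite mulr0.
rewrite ortho; last by have /(congr1 tag) := dpq.
case: eqP => // tpq; case/eqP: pq.
case: p q dpq tpq => [x k] [y m] dpq /= xy; subst y.
by congr existT; move/eqP: dpq; rewrite eq_Tagged => /eqP.
Qed.
End Correspondence.

Lemma dominated_retract (a b : vertex G -> nat) : dominated a b ->
  retract (fun i : {v : vertex G & 'I_(a v)} => tag i)
          (fun j : {v : vertex G & 'I_(b v)} => tag j).
Proof.
elim=> {a b} [a b ab|a b c _ ab _ bc|a|a].
- by apply: retract_count => v; rewrite !(card_tag_fiber _ id) !big_pred1_eq.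
- exact: retract_trans ab bc.
- apply: (@retract_trans _ {e : edge G & 'I_(a (src e))} _ _ (fun p => tgt (tag p))).
    apply: retract_count => v; rewrite (card_tag_fiber _ id) big_pred1_eq.
    by rewrite card_tag_fiber; apply/eq_leq/eq_bigl => e; rewrite inE.
  apply: (@retract_push a _ (@src G) (@tgt G) edg ghost) => e f sef.
  by rewrite -mulrA sef src_edg ghost_edg.
(* A regular vertex is split by its outgoing edges through the Cuntz-Krieger relation, while a sink
   is carried over unchanged. *)
- pose X : finType := (edge G + {v : vertex G | is_sink v})%type.
  pose base (x : X) := match x with inl e => src e | inr u => val u end.
  pose label (x : X) := match x with inl e => tgt e | inr u => val u end.
  pose al (x : X) := match x with inl e => edg e | inr u => vert (val u) end.
  pose be (x : X) := match x with inl e => ghost e | inr u => vert (val u) end.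
  apply: (@retract_trans _ {x : X & 'I_(a (base x))} _ _ (fun p => label (tag p))).
    apply: (@retract_expand a X base label al be) => v; rewrite big_sumType /=.
    under eq_bigr => e _ do rewrite edg_tgt.
    under [X in _ + X]eq_bigr => u _ do rewrite !vertM !eqxx vertM eqxx.
    have [sink|] := boolP (is_sink v).
      rewrite (big_pred1 (exist _ v sink)) => [|u]; last by rewrite /= -val_eqE.
      rewrite big1 ?add0r // => e /eqP ev.
      by move/eqP/setP/(_ e): sink; rewrite !inE ev eqxx.
    rewrite /is_sink -card_gt0 => reg; rewrite [X in _ + X]big1 => [|u /eqP uv]; last first.
      by move: reg; rewrite -uv card_gt0 => /negP[]; exact: (valP u).
    by rewrite addr0 [RHS]vert_ck //; apply: eq_bigl => e; rewrite inE.
  apply: retract_count => v; rewrite (card_tag_fiber _ id) big_pred1_eq.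
  rewrite card_tag_fiber big_sumType /= leq_add //.
    by apply/eq_leq/eq_bigl => e; rewrite inE.
  have [sink|nsink] := boolP (is_sink v).
    by rewrite (big_pred1 (exist _ v sink)) ?muln1 // => u; rewrite /= -val_eqE.
  by rewrite big1 // => u /eqP uv; case/negP: nsink; rewrite -uv; exact: (valP u).
Qed.

(** With [k = 2], the square of the algebra is a direct summand of the algebra. Summing the
    retraction coefficients over all vertices gives a 2 by 1 matrix with a right inverse, against
    UGN. *)
Lemma collapses_not_UGN : collapses G -> ~ UGN L.
Proof.
move=> /(_ 2%N)/dominated_retract[A [B AB]] /UGN_matrixP ugn.
pose tg (n : nat) (v : vertex G) (p : 'I_n) := Tagged (fun _ : vertex G => 'I_n) (i := v) p.
suff /ugn : (\matrix_(p < 2, r < 1) \sum_w (\sum_v vert v * A (tg _ v p) (tg _ w r)) * vert w) *m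
    (\matrix_(r < 1, p < 2) \sum_w vert w * (\sum_v B (tg _ w r) (tg _ v p) * vert v)) = 1%:M by [].
(* Orthogonality of the vertices kills the cross terms of the two sums. *)
have collapse (X Y : vertex G -> L) :
    (\sum_w X w * vert w) * (\sum_w vert w * Y w) = \sum_w X w * vert w * Y w.
  rewrite mulr_suml; apply: eq_bigr => w _.
  rewrite mulr_sumr (bigD1 w) //= big1 => [|u /negPf uw].
    by rewrite addr0 -!mulrA [vert w * (vert w * _)]mulrA vertM eqxx.
  by rewrite -mulrA [vert w * (vert u * _)]mulrA vertM eq_sym uw mul0r mulr0.
apply/matrixP => p q; rewrite !mxE.
(* The retraction identity evaluates the inner sums. Only [u = v] with [p = q] survives, and the
   vertices add up to 1. *)
transitivity (\sum_v \sum_u vert v * (if tg 2 v p == tg 2 u q then vert v else 0) * vert u).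
  transitivity (\sum_(j : {v : vertex G & 'I_1}) \sum_v \sum_u
      vert v * (A (tg _ v p) j * vert (tag j) * B j (tg _ u q)) * vert u); last first.
    rewrite exchange_big; apply: eq_bigr => v _; rewrite exchange_big; apply: eq_bigr => u _.
    by rewrite -(AB (tg 2 v p)) mulr_sumr mulr_suml.
  pose F w (r : 'I_1) := \sum_v \sum_u
    vert v * (A (tg _ v p) (tg _ w r) * vert w * B (tg _ w r) (tg _ u q)) * vert u.
  transitivity (\sum_w \sum_r F w r); last first.
    by rewrite (sig_big_dep _ (fun _ _ => true)); apply: eq_big => // -[].
  rewrite exchange_big; apply: eq_bigr => r _; rewrite !mxE collapse; apply: eq_bigr => w _.
  rewrite !mulr_suml; apply: eq_bigr => v _.
  by rewrite mulr_sumr; apply: eq_bigr => u _; rewrite !mulrA.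
have [->|pq] := eqVneq p q; last first.
  rewrite big1 // => v _; rewrite big1 // => u _.
  by case: eqP => [[_ /eqP]|_]; rewrite ?(negPf pq) // mulr0 mul0r.
rewrite mulr1n one_sum; apply: eq_bigr => v _; rewrite (bigD1 v) //= eqxx big1 => [|u uv].
  by rewrite addr0 !vertM !eqxx vertM eqxx.
by case: eqP => [[/eqP]|_]; rewrite ?(eq_sym v) ?(negPf uv) // mulr0 mul0r.
Qed.
End Retracts.

(** * Assembling the two directions along the elimination process *)

Lemma trivial_graph_isolated (G : digraph) : is_trivial_graph G -> has_isolated_vertex G.
Proof.
case=> V1 E0; have /card_gt0P[v _] : 0 < #|vertex G| by rewrite V1.
have no_edge (A : {set edge G}) : A == finset.set0.
  by rewrite -cards_eq0 -leqn0 -E0 max_card.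
by exists v; rewrite /isolated /is_source /is_sink !no_edge.
Qed.

Lemma elim_step_collapses (G H : digraph) :
  elim_step G H -> ~ has_isolated_vertex G -> collapses H -> collapses G.
Proof.
case=> [v hv _ niso|/trivial_graph_isolated //]; apply: source_elim_collapses.
by apply: contra_notN niso => sink_v; exists v; rewrite /isolated hv.
Qed.

Theorem theorem3p16 (K : fieldType) (E : digraph) (hE : 0 < #|vertex E|)
    (l : nat) (G : nat -> digraph) (hG : elim_process E l G) :
  UGN (leavitt K E) <->
  (exists2 i : nat, i <= l & has_isolated_vertex (G i)) \/
  has_source_cycle (G l).
Proof.
case: hG => <- step _ halt; split=> [ugn|].
  apply: contrapT => /not_orP[niso nsc].
  have niso_i i : i <= l -> ~ has_isolated_vertex (G i) by move=> il ?; apply: niso; exists i.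
  (* The other way of halting would give an isolated vertex at stage [l.-1]. *)
  have sf : source_free (G l).
    case: halt => // -[l_gt0 /trivial_graph_isolated iso].
    by case: (niso_i _ (leq_pred l)).
  apply: (@collapses_not_UGN K (G 0)) ugn.
  suff: forall k, k <= l -> collapses (G (l - k)) by move/(_ l (leqnn l)); rewrite subnn.
  (* Collapsing is carried backwards from stage [l], where source-freeness provides it, to stage
     0. *)
  elim=> [_|k IHk kl]; first by rewrite subn0; exact: source_free_collapses.
  have lk : (l - k.+1).+1 = l - k by rewrite subnSK.
  apply: elim_step_collapses (niso_i _ (leq_subr _ _)) (IHk (ltnW kl)).
  by rewrite -lk; apply: step; rewrite lk leq_subr.
(* A balanced function at any stage extends back to stage 0, where it yields a representation. *)
suff back i : i <= l -> has_balanced (G i) -> UGN (leavitt K (G 0)).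
  case=> [[i il /isolated_balanced]|/source_cycle_balanced]; exact: back.
elim: i => [_ [d [v [bal dv]]]|i IHi il]; first exact: UGN_of_balanced bal dv.
by move/(elim_step_balanced (step _ il)); exact: IHi (ltnW il).
Qed.
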